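(* For $n,k\ge 0$ let $\ell_{n,k}$ be the number of linear intervals of height $k$ in $\mathbb{F}_n^2$. Then $$\sum_{n,k\ge0}\ell_{n,k}x^ny^k=\frac{x^4y^4+x^4y^3+1}{1-x-x^2}+\frac{x^2y(x^2-1)(x^3y^2-1)}{(xy-1)(x^2+x-1)^2(x^2y-1)}.$$
   Context: A Dyck path of semilength $n\ge 0$ is a lattice path from $(0,0)$ to $(2n,0)$ with steps $U=(1,1)$ and $D=(1,-1)$ that never goes below the $x$-axis; it is identified with its word over $\{U,D\}$. A path avoids a pattern $\alpha$ if $\alpha$ does not occur as a factor (block of consecutive steps). $\mathcal{F}_n^2$ is the set of Dyck paths of semilength $n$ avoiding $DUU$ and $DDD$, ordered by the Stanley order: $P\le Q$ iff $P$ lies weakly below $Q$ when both are drawn in the plane; $\mathbb{F}_n^2=(\mathcal{F}_n^2,\le)$. An interval is $[P,Q]=\{R:P\le R\le Q\}$ for $P\le Q$ (including $P=Q$); its height is the length of a maximal chain from $P$ to $Q$; it is linear if any two of its elements are comparable. *)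

(* Defs.v *)
From HB Require Import structures.
From mathcomp Require Import all_boot all_order all_algebra.
From mathcomp Require Import boolp.

Set Implicit Arguments.
Unset Strict Implicit.
Unset Printing Implicit Defensive.

Import Order.TTheory GRing.Theory Num.Theory.

Local Open Scope ring_scope.

(* [fps R] is R[[t]], with the Cauchy product; a series is a unit when its
   constant coefficient is.  It is again a [comUnitRingType], so R[[x, y]] is
   obtained as [fps (fps R)], the outer variable being x. *)
Record fps (R : Type) := FPS { fcoef : nat -> R }.

HB.instance Definition _ (R : Type) := gen_eqMixin (fps R).
HB.instance Definition _ (R : Type) := gen_choiceMixin (fps R).

Lemma fpsP (R : Type) (f g : fps R) : (forall n, fcoef f n = fcoef g n) -> f = g.
Proof. by case: f g => [f] [g] /= e; congr FPS; apply: funext. Qed.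

Section FpsZmodule.
Variable R : zmodType.
Implicit Types f g h : fps R.

Definition fps_zero : fps R := FPS (fun=> 0).
Definition fps_opp f := FPS (fun n => - fcoef f n).
Definition fps_add f g := FPS (fun n => fcoef f n + fcoef g n).

Fact fps_addA : associative fps_add.
Proof. by move=> f g h; apply: fpsP => n /=; rewrite addrA. Qed.
Fact fps_addC : commutative fps_add.
Proof. by move=> f g; apply: fpsP => n /=; rewrite addrC. Qed.
Fact fps_add0 : left_id fps_zero fps_add.
Proof. by move=> f; apply: fpsP => n /=; rewrite add0r. Qed.
Fact fps_addN : left_inverse fps_zero fps_opp fps_add.
Proof. by move=> f; apply: fpsP => n /=; rewrite addNr. Qed.

HB.instance Definition _ :=
  GRing.isZmodule.Build (fps R) fps_addA fps_addC fps_add0 fps_addN.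
End FpsZmodule.

Section FpsRing.
Variable R : comNzRingType.
Implicit Types f g h : fps R.

Definition fps_const (c : R) : fps R := FPS (fun n => if n == 0%N then c else 0).
Definition fps_var : fps R := FPS (fun n => (n == 1%N)%:R).

Definition fps_mul f g :=
  FPS (fun n => \sum_(i < n.+1) fcoef f i * fcoef g (n - i)).

Let trunc N f : {poly R} := \poly_(i < N) fcoef f i.

Let coef_trunc N f n : (n < N)%N -> (trunc N f)`_n = fcoef f n.
Proof. by move=> ltnN; rewrite coef_poly ltnN. Qed.

Let coef_mul N f g n : (n < N)%N ->
  fcoef (fps_mul f g) n = (trunc N f * trunc N g)`_n.
Proof.
move=> ltnN; rewrite coefM /=; apply: eq_bigr => i _.
rewrite !coef_trunc //; first exact: leq_ltn_trans (leq_subr _ _) ltnN.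
by apply: leq_ltn_trans ltnN; rewrite -ltnS.
Qed.

Let coefM_eq (p p' q q' : {poly R}) n :
    (forall i, (i <= n)%N -> p`_i = p'`_i) ->
    (forall i, (i <= n)%N -> q`_i = q'`_i) ->
  (p * q)`_n = (p' * q')`_n.
Proof.
move=> ep eq; rewrite !coefM; apply: eq_bigr => i _.
by rewrite ep -1?ltnS // eq // leq_subr.
Qed.

Fact fps_mulA : associative fps_mul.
Proof.
move=> f g h; apply: fpsP => n; rewrite !(@coef_mul n.+1) //.
transitivity ((trunc n.+1 f * (trunc n.+1 g * trunc n.+1 h))`_n).
  apply: coefM_eq => // i lein.
  by rewrite coef_trunc ?ltnS // (@coef_mul n.+1) ?ltnS.
rewrite mulrA; apply: coefM_eq => // i lein.
by rewrite coef_trunc ?ltnS // (@coef_mul n.+1) ?ltnS.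
Qed.

Fact fps_mulC : commutative fps_mul.
Proof. by move=> f g; apply: fpsP => n; rewrite !(@coef_mul n.+1) // mulrC. Qed.

Fact fps_mul1 : left_id (fps_const 1) fps_mul.
Proof.
move=> f; apply: fpsP => n /=; rewrite big_ord_recl /= mul1r subn0 big1 ?addr0 //.
by move=> i _; rewrite mul0r.
Qed.

Fact fps_mulDl : left_distributive fps_mul (@fps_add R).
Proof.
move=> f g h; apply: fpsP => n /=; rewrite -big_split /=.
by apply: eq_bigr => i _; rewrite mulrDl.
Qed.

Fact fps_1_neq0 : fps_const 1 != 0 :> fps R.
Proof.
apply/eqP => /(congr1 (fun f => fcoef f 0)) /= /eqP.
by rewrite (negPf (oner_neq0 R)).
Qed.

HB.instance Definition _ := GRing.Zmodule_isComNzRing.Build (fps R)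
  fps_mulA fps_mulC fps_mul1 fps_mulDl fps_1_neq0.
End FpsRing.

Section FpsUnitRing.
Variable R : comUnitRingType.
Implicit Types f g : fps R.

Definition fps_unit : {pred fps R} := fun f => fcoef f 0 \is a GRing.unit.

(* The first n coefficients of the inverse g of f, obtained by solving
   \sum_(j <= m) f_(m - j) g_j = (m == 0) for g_m. *)
Fixpoint fps_inv_seq f (n : nat) : seq R :=
  if n is m.+1 then
    let s := fps_inv_seq f m in
    rcons s ((fcoef f 0)^-1 *
             ((m == 0%N)%:R - \sum_(j < m) fcoef f (m - j) * s`_j))
  else [::].

Definition fps_inv f : fps R :=
  if f \in fps_unit then FPS (fun n => (fps_inv_seq f n.+1)`_n) else f.

Let size_inv_seq f n : size (fps_inv_seq f n) = n.
Proof. by elim: n => //= n IHn; rewrite size_rcons IHn. Qed.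

Let nth_inv_seq f n m : (m < n)%N ->
  (fps_inv_seq f n)`_m = (fps_inv_seq f m.+1)`_m.
Proof.
elim: n => // n IHn; rewrite ltnS leq_eqVlt => /orP[/eqP -> //|ltmn].
by rewrite -IHn //= nth_rcons size_inv_seq ltmn.
Qed.

Fact fps_mulVr : {in fps_unit, left_inverse 1 fps_inv *%R}.
Proof.
move=> f uf; rewrite /fps_inv uf; apply: fpsP => n.
transitivity (\sum_(i < n.+1) (fps_inv_seq f i.+1)`_i * fcoef f (n - i)) => //.
rewrite big_ord_recr /= subnn nth_rcons size_inv_seq ltnn eqxx.
rewrite mulrC mulrA divrr // mul1r.
under eq_bigr => i _ do rewrite -[rcons _ _]/(fps_inv_seq f i.+1) mulrC
  -(@nth_inv_seq f n) //.
by rewrite addrC subrK; case: n.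
Qed.

Fact fps_unitPl f g : g * f = 1 -> f \in fps_unit.
Proof.
move=> /(congr1 (fun h => fcoef h 0)) /=; rewrite big_ord1 subnn => e.
by apply/unitrPr; exists (fcoef g 0); rewrite mulrC.
Qed.

Fact fps_inv_out : {in [predC fps_unit], fps_inv =1 id}.
Proof. by move=> f; rewrite inE /= /fps_inv => /negPf ->. Qed.

HB.instance Definition _ := GRing.ComNzRing_hasMulInverse.Build (fps R)
  fps_mulVr fps_unitPl fps_inv_out.
End FpsUnitRing.

Notation fps2 R := (fps (fps R)).
Definition varx (R : comNzRingType) : fps2 R := fps_var (fps R).
Definition vary (R : comNzRingType) : fps2 R := fps_const (fps_var R).
Definition gf2 (R : comNzRingType) (a : nat -> nat -> R) : fps2 R :=
  FPS (fun n => FPS (a n)).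

Section Intervals.
Variables (d : Order.disp_t) (T : finPOrderType d).
Implicit Types (P Q : T) (I C : {set T}).

Definition is_chain C : bool := [forall P in C, forall Q in C, (P >=< Q)%O].

Definition poset_itv P Q : {set T} := [set S | (P <= S <= Q)%O].

Definition intervals : {set {set T}} :=
  [set I | [exists P, exists Q, (P <= Q)%O && (I == poset_itv P Q)]].

Definition max_chain I C : bool :=
  maxset (fun C' : {set T} => (C' \subset I) && is_chain C') C.

(* A chain with m + 1 elements has length m; the largest value is taken, so
   that no gradedness of the poset is presupposed. *)
Definition height I : nat := \max_(C : {set T} | max_chain I C) #|C|.-1.

Definition linear_intervals (k : nat) : {set {set T}} :=
  [set I in intervals | is_chain I && (height I == k)].
End Intervals.

(* A step is a boolean: true is U = (1,1), false is D = (1,-1). *)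
Local Notation U := true (only parsing).
Local Notation D := false (only parsing).

Definition ordinate (w : seq bool) (i : nat) : int :=
  (count_mem U (take i w))%:Z - (count_mem D (take i w))%:Z.

Definition is_dyck (w : seq bool) : bool :=
  all (fun i => 0 <= ordinate w i) (iota 0 (size w).+1)
  && (ordinate w (size w) == 0).

Definition avoids (a w : seq bool) : bool := ~~ infix a w.

Definition inF2 (w : seq bool) : bool :=
  [&& is_dyck w, avoids [:: D; U; U] w & avoids [:: D; D; D] w].

Record F2 (n : nat) := MkF2 { f2word :> (n.*2).-tuple bool; _ : inF2 f2word }.

HB.instance Definition _ (n : nat) := [isSub for @f2word n].
HB.instance Definition _ (n : nat) := [Finite of F2 n by <:].

(* Paths have their vertices at the same abscissas and are affine in between,
   so P is weakly below Q iff it is so at each integer abscissa. *)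
Definition stanley_le (n : nat) (P Q : F2 n) : bool :=
  [forall i : 'I_(n.*2).+1, ordinate P i <= ordinate Q i].

Section Stanley.
Variable n : nat.

Fact stanley_le_refl : reflexive (@stanley_le n).
Proof. by move=> P; apply/forallP => i. Qed.

Fact stanley_le_trans : transitive (@stanley_le n).
Proof.
move=> Q P S /forallP lePQ /forallP leQS; apply/forallP => i.
exact: le_trans (lePQ i) (leQS i).
Qed.

Let ordinateS (w : seq bool) i : (i < size w)%N ->
  ordinate w i.+1 = ordinate w i + (if nth D w i then 1 else -1).
Proof.
move=> ltiw; rewrite /ordinate (take_nth D ltiw) -cats1 !count_cat /=.
case: (nth D w i) => /=; rewrite !addn0 ?addn1 ?PoszD intS.
  by rewrite [1 + _]addrC addrAC.
by rewrite opprD addrA addrAC.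
Qed.

Fact stanley_le_anti : antisymmetric (@stanley_le n).
Proof.
move=> P Q /andP[/forallP lePQ /forallP leQP].
have e i : (i <= n.*2)%N -> ordinate P i = ordinate Q i.
  rewrite -ltnS => lti; apply/eqP.
  by rewrite eq_le (lePQ (Ordinal lti)) (leQP (Ordinal lti)).
apply/val_inj/val_inj/(@eq_from_nth _ D); first by rewrite /= !size_tuple.
move=> i; rewrite size_tuple => lti.
have := e _ lti; rewrite !ordinateS ?size_tuple // e 1?ltnW // => /addrI.
by do 2!case: nth.
Qed.
End Stanley.

Fact stanley_display : Order.disp_t. Proof. exact: (Order.Disp tt tt). Qed.

HB.instance Definition _ (n : nat) := Order.Le_isPOrder.Build stanley_display (F2 n)
  (@stanley_le_refl n) (@stanley_le_anti n) (@stanley_le_trans n).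

Definition ell (n k : nat) : nat := #|@linear_intervals _ (F2 n) k|.

(* Main.v *)
(* Read from right to left, a path avoiding DUU and DDD with N + 1 up steps is
   D, then N blocks, each D or UD, never two D blocks in a row, then up steps.
   Writing 1 for a block D and 0 for a block UD gives a binary word of length N
   without two adjacent 1s, and the Stanley order becomes domination of prefix
   sums: going up moves 1s to the left, or lets a new one in at the right end.
   The common prefix of two words can be stripped, so a linear interval of
   positive height is determined by a pair (0P, 10Q).  If the lower word is 00P,
   its first 1 slides to the front and nothing else moves, except in the two
   intervals [001, 101] and [000, 101].  If it is 01P, one step peels off and
   an interval [P, Q] of the same kind remains, or nothing does.  These
   recursions, translated to series, are linear equations whose solution is the
   stated fraction. *)
Require Import Defs.
From HB Require Import structures.
From mathcomp Require Import all_boot all_order all_algebra.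
From mathcomp Require Import zify ring.
Import Order.TTheory GRing.Theory Num.Theory.

Set Implicit Arguments.
Unset Strict Implicit.
Unset Printing Implicit Defensive.

(** * Domination of prefix sums on binary words *)

Local Open Scope nat_scope.

(* Each prefix sum of P is at most d plus the one of Q, for equally long words. *)
Fixpoint dom (d : nat) (P Q : seq bool) : bool :=
  match P, Q with
  | a :: P', b :: Q' => (a <= d + b) && dom (d + b - a) P' Q'
  | _, _ => true
  end.

(** The test [a <= d + b] keeps the truncated subtraction exact, so the slack after each letter is
    [d] plus the prefix sum of [Q] minus that of [P]. *)
Lemma domP d P Q : size P = size Q ->
  reflect (forall i, count id (take i P) <= d + count id (take i Q))
          (dom d P Q).
Proof.
elim: P Q d => [|a P IHP] [|b Q] // d; first by move=> _; constructor.
case=> eqPQ /=; apply: (iffP andP) => [[leab /(IHP _ _ eqPQ) le_i] [|i] //=|le_i].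
  by have := le_i i; case: (a) (b) leab => [] [] /=; lia.
split; first by have := le_i 1; rewrite /= !take0; case: (a) (b) => [] [] /=; lia.
apply/IHP => // i; have := le_i i.+1; have := le_i 1; rewrite /= !take0.
by case: (a) (b) => [] [] /=; lia.
Qed.

Lemma dom_refl d P : dom d P P.
Proof. by apply/domP => // i; lia. Qed.

Lemma dom_trans d e P Q R : size P = size Q -> size Q = size R ->
  dom d P Q -> dom e Q R -> dom (d + e) P R.
Proof.
move=> PQ QR /(domP _ PQ) dPQ /(domP _ QR) dQR; apply/domP; first by rewrite PQ.
by move=> i; have := dPQ i; have := dQR i; lia.
Qed.

Lemma dom0_trans P Q R : size P = size Q -> size Q = size R ->
  dom 0 P Q -> dom 0 Q R -> dom 0 P R.
Proof. exact: (@dom_trans 0 0). Qed.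

Lemma dom_anti P Q : size P = size Q -> dom 0 P Q -> dom 0 Q P -> P = Q.
Proof.
elim: P Q => [|a P IHP] [|b Q] //= [/IHP{}IHP].
by case: a b => [] [] //= ? ?; rewrite IHP.
Qed.

(** * Binary words without adjacent 1s *)

Fixpoint nonadj (w : seq bool) : bool :=
  match w with
  | true :: (true :: _) => false
  | _ :: w' => nonadj w'
  | [::] => true
  end.

Fixpoint words (n : nat) : seq (seq bool) :=
  if n is m.+1 then
    map (cons false) (words m) ++
    map (cons true) [seq w <- words m | ~~ head false w]
  else [:: [::]].

Arguments words : simpl never.

Lemma wordsS n : words n.+1 = map (cons false) (words n) ++
  map (cons true) [seq w <- words n | ~~ head false w].
Proof. by []. Qed.

Lemma nonadjF w : nonadj (false :: w) = nonadj w. Proof. by []. Qed.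
Lemma nonadjT w : nonadj (true :: w) = ~~ head false w && nonadj w.
Proof. by case: w => [|[]]. Qed.

Lemma cons_inj (T : Type) (x : T) : injective (cons x).
Proof. by move=> u v []. Qed.

Lemma mem_words n w : (w \in words n) = nonadj w && (size w == n).
Proof.
elim: n w => [|n IHn] w.
  by case: w => [|a w]; rewrite inE //= andbF.
rewrite wordsS mem_cat; case: w => [|[] w].
- by apply/negP => /orP[/mapP[]|/mapP[]].
- rewrite (_ : (_ \in map (cons false) _) = false); last by case: mapP => [[]|].
  by rewrite (mem_map (@cons_inj _ _)) mem_filter IHn nonadjT eqSS andbA.
rewrite (_ : (_ \in map (cons true) _) = false); last by case: mapP => [[]|].
by rewrite (mem_map (@cons_inj _ _)) IHn orbF eqSS.
Qed.

Lemma words_uniq n : uniq (words n).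
Proof.
elim: n => [|n IHn] //; rewrite wordsS cat_uniq !(map_inj_uniq (@cons_inj _ _)).
rewrite IHn filter_uniq //= andbT.
by apply/hasPn => w /mapP[u _ ->]; case: mapP => [[]|].
Qed.

Lemma words_head0 n :
  [seq w <- words n.+1 | ~~ head false w] = map (cons false) (words n).
Proof.
rewrite wordsS filter_cat (all_filterP _) ?all_map; last by apply/allP.
by rewrite (@eq_in_filter _ _ pred0) ?filter_pred0 ?cats0 // => w /mapP[u _ ->].
Qed.

(** After a leading 1 the next letter can only be 0; this gives the Fibonacci recursion. *)
Lemma wordsSS n :
  words n.+2 = map (cons false) (words n.+1) ++
               map (fun w => [:: true, false & w]) (words n).
Proof. by rewrite -[LHS]/(_ ++ map _ _) words_head0 -map_comp. Qed.

(** * Intervals of words, linearity, and removal of common prefixes *)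

Definition itv P Q := [seq R <- words (size P) | dom 0 P R && dom 0 R Q].

Definition wcomparable P Q := dom 0 P Q || dom 0 Q P.

(* The interval between P and Q is linear of height k. *)
Definition lin k P Q := (size (itv P Q) == k.+1) && all2rel wcomparable (itv P Q).

Lemma mem_itv P Q R :
  (R \in itv P Q) = [&& nonadj R, size R == size P, dom 0 P R & dom 0 R Q].
Proof. by rewrite mem_filter mem_words andbC -andbA. Qed.

Lemma linP k P Q : reflect (size (itv P Q) = k.+1 /\
    {in itv P Q &, forall R S, wcomparable R S}) (lin k P Q).
Proof.
by apply: (iffP andP) => [[/eqP ? /allrelP]|[/eqP ? /allrelP]].
Qed.

(** An order embedding that carries one interval onto the other preserves both the number of words
    and comparability. It serves to strip common prefixes. *)
Lemma lin_map (f : seq bool -> seq bool) P Q P' Q' : injective f ->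
    {mono f : R S / dom 0 R S} ->
    (forall R, (R \in itv P' Q') = (R \in map f (itv P Q))) ->
  forall k, lin k P' Q' = lin k P Q.
Proof.
move=> injf monof eqI k.
have eqp : perm_eq (itv P' Q') (map f (itv P Q)).
  by apply: uniq_perm => //; rewrite ?map_inj_uniq // ?filter_uniq ?words_uniq.
rewrite /lin (perm_size eqp) size_map; congr (_ && _).
rewrite (eq_allrel_meml _ _ eqI) (eq_allrel_memr _ _ eqI) allrel_mapl allrel_mapr.
by apply: eq_allrel => R S; rewrite /wcomparable !monof.
Qed.

Lemma lin_cons_false k P Q : lin k (false :: P) (false :: Q) = lin k P Q.
Proof.
apply: (@lin_map (cons false)) => [u v []|//|[|[] R]] //.
- by rewrite mem_itv; case: mapP => [[]|].
- by rewrite mem_itv /= !andbF; case: mapP => [[]|].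
by rewrite mem_map ?mem_itv // => u v [].
Qed.

Lemma lin_cons_true_false k P Q : lin k [:: true, false & P] [:: true, false & Q] = lin k P Q.
Proof.
apply: (@lin_map (fun R => [:: true, false & R])) => [u v [] //|//|].
case=> [|[] [|[] R]]; try by rewrite mem_itv /= ?andbF; case: mapP => [[]|].
by rewrite mem_map ?mem_itv //= => u v [].
Qed.

(** The size test leaves at least one word in the interval, and that word links [P] to [Q]. Hence
    sums of [lin] over all pairs need no separate order condition. *)
Lemma lin_dom k P Q : size P = size Q -> lin k P Q -> dom 0 P Q.
Proof.
move=> eqPQ /linP[+ _]; case e: (itv P Q) => [|R s] // _.
have: R \in itv P Q by rewrite e mem_head.
by rewrite mem_itv => /and4P[_ /eqP eR ? ?]; apply: (@dom0_trans P R Q); rewrite ?eR.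
Qed.

Lemma lin_true_false k P Q : size P = size Q -> lin k (true :: P) (false :: Q) = false.
Proof. by move=> e; apply/negP => /lin_dom; rewrite /= e => /(_ erefl). Qed.

(** * Sliding the first 1 to the front *)

(* The rest of the word after its first 1 has slid out to the front. *)
Fixpoint zap (w : seq bool) : seq bool :=
  match w with
  | true :: w' => false :: w'
  | false :: w' => false :: zap w'
  | [::] => [::]
  end.

Lemma size_zap w : size (zap w) = size w.
Proof. by elim: w => [|[] w IHw] //=; rewrite IHw. Qed.

Lemma nonadj_zap w : nonadj w -> nonadj (zap w).
Proof. by elim: w => [|[] [|[] w] IHw]. Qed.

Lemma head_zap w : head false (zap w) = false.
Proof. by case: w => [|[]]. Qed.

(** Deleting the first 1 lowers the prefix sums from there on by one; before it they are 0. With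
    [dom_zap1], this makes [zap P] the least word of its length that dominates [P] up to slack 1. *)
Lemma dom_zap d P Q : dom d.+1 P Q -> dom d (zap P) Q.
Proof.
elim: P Q d => [|[] P IHP] [|b Q] d //=.
by have -> : d.+1 + b - 0 = (d + b - 0).+1; [lia | exact: IHP].
Qed.

Lemma dom_zap1 P : dom 1 P (zap P).
Proof. by elim: P => [|[] P IHP] //=; rewrite dom_refl. Qed.

Lemma dom_zap_eq P R : size P = size R -> dom 1 P R -> dom 0 R (zap P) -> R = zap P.
Proof.
elim: P R => [|a P IHP] [|b R] //= [eqPR].
case: a b => [] [] //= h1 h2; congr (_ :: _); first exact: dom_anti.
exact: IHP.
Qed.

Fixpoint lead (w : seq bool) : nat :=
  if w is false :: w' then (lead w').+1 else 0.


(* The words met while the first 1 of 0P slides to the front; when P has no 1,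
   the sliding 1 first enters at the right end. *)
Fixpoint slides (P : seq bool) : seq (seq bool) :=
  (true :: zap P) ::
  (if P is false :: P' then map (cons false) (slides P') else [:: false :: P]).

Lemma size_slides P : size (slides P) = (lead P).+2.
Proof. by elim: P => [|[] P IHP] //=; rewrite size_map IHP. Qed.

Lemma slides_uniq P : uniq (slides P).
Proof.
elim: P => [|[] P IHP] //=; rewrite map_inj_uniq ?IHP ?andbT; last by move=> u v [].
by apply/mapP => -[].
Qed.

(** By [dom_zap_eq] only the top word begins with 1. When [P] begins with 0, dropping the first 0 of
    the other members leaves an interval of the same kind; otherwise the only other member is
    [false :: P]. *)
Lemma mem_slides P R : nonadj P ->
  (R \in itv (false :: P) (true :: zap P)) = (R \in slides P).
Proof.
rewrite mem_itv; elim: P R => [|a P IHP] [|b R].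
- by [].
- by case: b R => [] [|[] R]; rewrite ?inE //= ?andbF.
- by move=> _; case: a {IHP}; rewrite //= inE; case: mapP => // -[].
case: b => naP.
  have eqS : slides (a :: P) = (true :: zap (a :: P)) ::
      (if a then [:: [:: false, a & P]] else map (cons false) (slides P)) by case: (a).
  rewrite eqS inE eqseq_cons eqxx (_ : (_ \in if a then _ else _) = false); last first.
    by case: (a); rewrite ?inE //; case: mapP => [[]|].
  rewrite orbF andTb; apply/idP/eqP => [/and4P[_ /eqP[eR] dPR dRP]|->].
    exact: (@dom_zap_eq (a :: P)).
  apply/and4P; split.
  - by rewrite nonadjT head_zap nonadj_zap.
  - exact/eqP/(congr1 S (size_zap (a :: P))).
  - exact: (dom_zap1 (a :: P)).
  exact: (dom_refl 0 (zap (a :: P))).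
case: a naP => naP.
  rewrite [slides _]/= !inE (_ : (false :: R == true :: _) = false) // orFb.
  apply/idP/eqP => [|[->]].
    case: R => [|[] R] /and4P[_ /eqP[eR]] //= h1 h2.
    by do 2!congr (_ :: _); apply: dom_anti.
  by rewrite [nonadj _]naP eqxx /= !dom_refl.
rewrite inE eqseq_cons /= mem_map; last by move=> u v [].
by rewrite -IHP //; case: R => [|[] R].
Qed.

Lemma slides_comp P : nonadj P -> {in slides P &, forall R S, wcomparable R S}.
Proof.
have top P' R : nonadj P' -> R \in slides P' -> dom 0 R (true :: zap P').
  by move=> na; rewrite -mem_slides // mem_itv => /and4P[].
elim: P => [|[] P IHP] na R S.
- by rewrite !inE => /orP[] /eqP -> /orP[] /eqP ->.
- rewrite !inE /wcomparable.
  by move=> /orP[] /eqP -> /orP[] /eqP ->; rewrite /= ?dom_refl ?orbT.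
move=> R_in S_in; move: (R_in) (S_in); rewrite /= !inE.
case/predU1P => [eR _|/mapP[R' R'in eR]].
  by rewrite /wcomparable eR [dom 0 S _](top (false :: P)) ?orbT.
case/predU1P => [eS|/mapP[S' S'in eS]].
  by rewrite /wcomparable eS [dom 0 R _](top (false :: P)).
by rewrite eR eS; exact: (IHP na _ _ R'in S'in).
Qed.

Lemma lin_slide k P : nonadj P -> lin k (false :: P) (true :: zap P) = (k == (lead P).+1).
Proof.
move=> na; have eqI R : (R \in itv (false :: P) (true :: zap P)) = (R \in slides P).
  exact: mem_slides.
have eqp : perm_eq (itv (false :: P) (true :: zap P)) (slides P).
  by apply: uniq_perm; rewrite ?slides_uniq ?filter_uniq ?words_uniq.
rewrite /lin (perm_size eqp) size_slides eqSS eq_sym andb_idr // => _.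
by apply/allrelP => R S; rewrite !eqI; apply: slides_comp.
Qed.

(** * Classification of the linear intervals from [0P] to [10Q] *)

Lemma lin_incomparable k P Q R S : R \in itv P Q -> S \in itv P Q ->
  ~~ wcomparable R S -> lin k P Q = false.
Proof. by move=> Rin Sin; apply: contraNF => /linP[_]; apply. Qed.

Lemma itv_nil P Q : size P = size Q -> ~~ dom 0 P Q -> itv P Q = [::].
Proof.
move=> ePQ ndPQ; case e: (itv P Q) => [//|R s].
have: R \in itv P Q by rewrite e mem_head.
rewrite mem_itv => /and4P[_ /eqP eR dPR dRQ].
by case/negP: ndPQ; apply: (@dom0_trans P R Q); rewrite ?eR.
Qed.

Lemma itv_refl P : nonadj P -> itv P P = [:: P].
Proof.
move=> na; apply/perm_small_eq => //; apply: uniq_perm.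
- by rewrite filter_uniq ?words_uniq.
- by [].
move=> R; rewrite mem_itv inE; apply/idP/eqP => [/and4P[_ /eqP eR ? ?]|->].
  exact: dom_anti.
by rewrite na eqxx dom_refl.
Qed.

Lemma lin_refl k P : nonadj P -> lin k P P = (k == 0).
Proof. by move=> na; rewrite /lin itv_refl // /allrel /= /wcomparable dom_refl !andbT eq_sym. Qed.

(** If [Q] is not [zap P], look for [Z] beginning with 0, strictly above [zap P] and below [Q]: then
    [01Z] and [10(zap P)] are incomparable members. Such a [Z] exists unless [Q] is the one-letter
    word 1, where the interval is a chain of 4 or 5 words. *)
Lemma lin_00_10 k P Q : size P = size Q -> nonadj P -> nonadj Q ->
  lin k [:: false, false & P] [:: true, false & Q] =
  if Q == zap P then k == (lead P).+2 else (Q == [:: true]) && (k == lead P + 3).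
Proof.
move=> ePQ naP naQ; case: eqP => [->|neQ].
  (* Here [[:: true, false & zap P]] is [true :: zap (false :: P)], a slide over one more 0. *)
  exact: (@lin_slide k (false :: P)).
case: eqP => [eQ|neQ1].
  have {naP} : P = [:: false] \/ P = [:: true].
    by move: ePQ; rewrite eQ; case: (P) => [|[] []] // _; [right|left].
  rewrite /lin /itv /words eQ; case=> -> /=.
    by rewrite /= eqSS eq_sym andbT.
  by rewrite /= eqSS eq_sym andbT.
apply/negP => linPQ; have d1 : dom 1 P Q by have := lin_dom _ linPQ; rewrite /= ePQ => ->.
have dz : dom 0 (zap P) Q by apply: dom_zap.
have zin : [:: true, false & zap P] \in itv [:: false, false & P] [:: true, false & Q].
  by rewrite mem_itv /= size_zap eqxx dz dom_zap1 nonadj_zap.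
suff [Z [naZ hZ eZ] [dZ dZQ nZ]] : exists2 Z,
    [/\ nonadj Z, head false Z = false & size Z = size Q] &
    [/\ dom 0 (zap P) Z, dom 0 Z Q & Z <> zap P].
  have Zin : [:: false, true & Z] \in itv [:: false, false & P] [:: true, false & Q].
    rewrite mem_itv nonadjF nonadjT hZ naZ /= eZ ePQ eqxx dZQ andbT.
    by apply: (@dom_trans 1 0 _ (zap P)); rewrite ?size_zap ?dom_zap1 ?ePQ ?eZ.
  move: linPQ; rewrite (lin_incomparable _ Zin zin) // /wcomparable /= orbF.
  by apply/negP => dZP; apply: nZ; apply: dom_anti; rewrite ?size_zap ?eZ.
case: Q => [|[] Q] in ePQ naQ neQ neQ1 {linPQ} d1 dz {zin} *.
- by case: (P) ePQ neQ.
- case: Q => [|[] Q] // in ePQ naQ neQ neQ1 d1 dz *.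
  have [Z1 eZ1] : exists Z1, zap P = [:: false, false & Z1].
    case: (P) ePQ naP => [|[] [|[] P']] // _ _; first by exists P'.
      by exists P'.
    by exists (zap P').
  have sZ1 : size Z1 = size Q.
    by have := size_zap P; rewrite eZ1 ePQ => -[].
  have naZ1 : nonadj Z1 by have := nonadj_zap naP; rewrite eZ1.
  (* Sliding the first 1 of zap P as well gives a word that is incomparable to
     the one where the first 1 of P has slid to the front. *)
  exists [:: false, true & zap Z1]; rewrite ?eZ1 /=; split => //.
  - by have := nonadj_zap naZ1; have := head_zap Z1; case: (zap _) => [|[]].
  - by rewrite size_zap sZ1.
  - by rewrite dom_zap1.
  by move: dz; rewrite eZ1; apply: dom_zap.
(* The upper word begins with 0 and serves as [Z] itself. *)
by exists (false :: Q); split => //; rewrite ?dom_refl //; split; rewrite ?dom_refl.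
Qed.

Definition only P Q := all (fun R => head false R || (R == P)) (itv P Q).

(** The members are [10R] for [R] in [itv P Q], a copy of that interval, and [01R] for those [R]
    that begin with 0. Comparability of [01R] with [10P] forces [R = P], so a chain consists of the
    copy and [01P] below it, which accounts for one unit of height. *)
Lemma lin_01_10 k P Q : size P = size Q -> nonadj (true :: P) ->
  lin k [:: false, true & P] [:: true, false & Q] = [&& only P Q, 0 < k & lin k.-1 P Q].
Proof.
move=> ePQ naP; have [dPQ|ndPQ] := boolP (dom 0 P Q); last first.
  rewrite /lin /only (itv_nil ePQ) // itv_nil //=; first by rewrite andbF.
  by rewrite ePQ.
have [hP nP] : head false P = false /\ nonadj P by case: (P) naP => [|[]].
pose I' := itv [:: false, true & P] [:: true, false & Q].
have in01 R : ([:: false, true & R] \in I') = (R \in itv P Q) && ~~ head false R.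
  by rewrite !mem_itv /= !eqSS; case: R => [|[] R] /=; rewrite ?andbF ?andbT.
have in10 R : ([:: true, false & R] \in I') = (R \in itv P Q).
  by rewrite !mem_itv /= !eqSS.
have Pin : P \in itv P Q by rewrite mem_itv nP eqxx dom_refl dPQ.
have bot R : R \in I' -> dom 0 [:: false, true & P] R by rewrite mem_itv => /and4P[].
have [onlyP|nonly] /= := boolP (only P Q); last first.
  apply/negP => /linP[_]; rewrite -/I' => cmp; case/negP: nonly; apply/allP => R Rin.
  have [//|hR] := boolP (head false R); apply/eqP/dom_anti.
  - by move: Rin; rewrite mem_itv => /and4P[_ /eqP].
  - have: wcomparable [:: false, true & R] [:: true, false & P].
      by apply: cmp; rewrite ?in01 ?in10 // Rin hR.
    by rewrite /wcomparable /= orbF.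
  by move: Rin; rewrite mem_itv => /and4P[].
have eqI : I' =i [:: false, true & P] :: map (fun R => [:: true, false & R]) (itv P Q).
  have inj2 : injective (fun w => [:: true, false & w]) by move=> u v [].
  case=> [|a [|b R]].
  - by rewrite inE mem_itv; case: mapP => [[]|].
  - by rewrite mem_itv inE /= ?andbF; case: mapP => [[]|]; case: (a).
  case: a b => [] [].
  - by rewrite mem_itv inE; case: mapP => [[]|].
  - by rewrite in10 inE (mem_map inj2).
  - rewrite in01 inE !eqseq_cons /= (_ : (_ \in map _ _) = false) ?orbF; last first.
      by case: mapP => [[]|].
    apply/andP/eqP => [[/(allP onlyP)/orP[->|/eqP]] //|->]; by rewrite Pin hP.
  by rewrite mem_itv /= !andbF inE; case: mapP => [[]|].
have eqp : perm_eq I' ([:: false, true & P] :: map (fun R => [:: true, false & R]) (itv P Q)).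
  apply: uniq_perm => //; first by rewrite filter_uniq ?words_uniq.
  rewrite /= map_inj_uniq; last by move=> u v [].
  by rewrite filter_uniq ?words_uniq // andbT; case: mapP => [[]|].
apply/linP/andP; rewrite -/I'; [case | case=> k0 /linP[sI cmp]].
  rewrite (perm_size eqp) /= size_map => -[sI] cmp; split.
    by rewrite -sI; case: (itv P Q) Pin.
  apply/linP; split; first by rewrite sI prednK // -sI; case: (itv P Q) Pin.
  move=> R S Rin Sin.
  by have: wcomparable [:: true, false & R] [:: true, false & S] by apply: cmp; rewrite in10.
split; first by rewrite (perm_size eqp) /= size_map sI prednK.
move=> R S Rin Sin; move: (Rin) (Sin); rewrite !eqI !inE.
case/predU1P => [-> _|/mapP[R' R'in ->]]; first by rewrite /wcomparable bot.
case/predU1P => [->|/mapP[S' S'in ->]]; last exact: (cmp _ _ R'in S'in).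
by rewrite /wcomparable bot ?orbT ?in10.
Qed.

(** When [P] lies below [Q], the word [Q] is a member of the inner interval that begins with 0, so
    [only] forces [Q = P]. *)
Lemma lin_01_10_head0 k P Q : size P = size Q -> nonadj P ->
    head false P = false -> nonadj Q -> head false Q = false ->
  lin k [:: false, true & P] [:: true, false & Q] = (Q == P) && (k == 1).
Proof.
move=> ePQ naP hP naQ hQ; rewrite lin_01_10 // ?nonadjT ?hP //.
have [->|neQP] /= := eqVneq Q P.
  by rewrite lin_refl // /only itv_refl //= eqxx orbT /=; case: k => [|[]].
apply/and3P => -[/allP onlyP k0 /(lin_dom ePQ) dPQ].
have: Q \in itv P Q by rewrite mem_itv naQ ePQ eqxx dPQ dom_refl.
by move/onlyP; rewrite hQ (negPf neQP).
Qed.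

(** The word [01(zap P)] lies between [00P] and [10Q], begins with 0 and differs from [00P], against
    [only]. *)
Lemma lin_0100_1010 k P Q : size P = size Q -> nonadj P -> nonadj Q ->
  lin k [:: false, true, false, false & P] [:: true, false, true, false & Q] = false.
Proof.
move=> ePQ naP naQ; rewrite lin_01_10 //=; last by rewrite ePQ.
apply/and3P => -[/allP onlyP k0 /lin_dom]; rewrite /= ePQ => /(_ erefl) dPQ.
have: [:: false, true & zap P] \in itv [:: false, false & P] [:: true, false & Q].
  rewrite mem_itv; apply/and4P; split.
  - by rewrite nonadjF nonadjT head_zap nonadj_zap.
  - by rewrite /= size_zap.
  - exact: (dom_zap1 P).
  exact: (dom_zap dPQ).
by move/onlyP.
Qed.

(** The condition [only] comes for free: a member of the inner interval that begins with 0 is some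
    [01R], and linearity of that interval forces [R = P]. *)
Lemma lin_0101_1010 k P Q : size P = size Q -> nonadj (true :: P) ->
  lin k [:: false, true, false, true & P] [:: true, false, true, false & Q] =
  (0 < k) && lin k.-1 [:: false, true & P] [:: true, false & Q].
Proof.
move=> ePQ naP; rewrite lin_01_10 //=; last by rewrite ePQ.
rewrite andb_idl // => /andP[_ ]; rewrite lin_01_10 // => /and3P[/allP onlyP _ _].
apply/allP => R0; rewrite mem_itv => /and4P[].
case: R0 => [|[] [|[] R]] // naR /eqP[eR] dPR dRQ.
have {naR} [hR naR'] : head false R = false /\ nonadj R.
  by case: (R) naR => [|[]].
have /onlyP : R \in itv P Q by rewrite mem_itv naR' eR eqxx [dom 0 P R]dPR.
by rewrite hR /= => /eqP ->.
Qed.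

(** * Recursions for the numbers of linear intervals *)

Definition nlin N k := \sum_(P <- words N) \sum_(Q <- words N) lin k P Q.
Definition nlin00 N k := \sum_(P <- words N) \sum_(Q <- words N)
  lin k [:: false, false & P] [:: true, false & Q].
(** The filter keeps [01P] free of adjacent 1s; after [10] every [Q] is allowed. *)
Definition nlin01 N k := \sum_(P <- words N | ~~ head false P) \sum_(Q <- words N)
  lin k [:: false, true & P] [:: true, false & Q].
Definition nlead N j := \sum_(P <- words N) (lead P == j).

Lemma nlin0 k : nlin 0 k = (k == 0).
Proof. by rewrite /nlin !big_seq1 lin_refl. Qed.

Lemma nlin1 k : nlin 1 k = (k == 0) + (k == 0) + (k == 1).
Proof.
rewrite /nlin /words /= !(big_cons, big_nil) lin_true_false // !lin_refl //.
rewrite (_ : lin k [:: false] [:: true] = (k == 1)); first by lia.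
by rewrite /lin /itv /words /= eqSS eq_sym andbT.
Qed.

(** A common prefix 0 or 10 is stripped, and a pair [(1P, 0Q)] contributes nothing. The pairs
    [(0P, 10Q)] are split by the first letter of [P]. *)
Lemma nlinSS N k : nlin N.+2 k = nlin N.+1 k + nlin N k + (nlin01 N k + nlin00 N k).
Proof.
have -> : nlin01 N k + nlin00 N k = \sum_(P <- words N.+1) \sum_(Q <- words N)
    lin k (false :: P) [:: true, false & Q].
  rewrite wordsS big_cat !big_map /= addnC; congr (_ + _).
  by rewrite /nlin01 big_filter.
rewrite /nlin wordsSS; set W := words N.+1; rewrite big_cat !big_map /=.
under eq_bigr => P _ do rewrite big_cat !big_map /=.
rewrite big_split /=.
under [X in _ + X = _]eq_bigr => P _ do rewrite big_cat !big_map /=.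
rewrite big_split /= addnAC -!addnA; congr (_ + _).
  by apply: eq_bigr => P _; apply: eq_bigr => Q _; rewrite lin_cons_false.
rewrite [X in X + _ = _]big_seq [X in X + _ = _]big1 ?add0n => [|P]; last first.
  rewrite mem_words => /andP[_ /eqP sP]; rewrite big_seq big1 // => Q.
  by rewrite mem_words => /andP[_ /eqP sQ]; rewrite lin_true_false //= sP sQ.
congr (_ + _).
by apply: eq_bigr => P _; apply: eq_bigr => Q _; rewrite lin_cons_true_false.
Qed.

Lemma nlin01_0 k : nlin01 0 k = (k == 1).
Proof.
by rewrite /nlin01 big_mkcond !big_seq1 /= lin_01_10_head0 // eqxx.
Qed.

Lemma nlin01_1 k : nlin01 1 k = (k == 1) + (k == 2).
Proof.
rewrite /nlin01 /words big_mkcond !(big_cons, big_nil) /= lin_01_10_head0 // eqxx !addn0.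
by congr (_ + _); rewrite /lin /itv /words /= eqSS eq_sym andbT.
Qed.

Lemma words_size N w : w \in words N -> size w = N.
Proof. by rewrite mem_words => /andP[_ /eqP]. Qed.

Lemma words_nonadj N w : w \in words N -> nonadj w.
Proof. by rewrite mem_words => /andP[]. Qed.

Lemma sum_eq_words N w (b : bool) : w \in words N ->
  \sum_(Q <- words N) ((Q == w) && b) = b.
Proof.
move=> win; rewrite (bigD1_seq w) ?words_uniq //= eqxx big1 ?addn0 // => Q.
by move/negPf ->.
Qed.

(** If [Q] begins with 0, only [Q = P] counts, with height 1. If [Q] begins with 10, a [P] beginning
    with 00 gives nothing and one beginning with 01 peels off one step. *)
Lemma nlin01SS N k :
  nlin01 N.+2 k = (k == 1) * size (words N.+1) + (0 < k) * nlin01 N k.-1.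
Proof.
rewrite /nlin01 -big_filter words_head0 big_map wordsSS.
under eq_bigr => P _ do rewrite big_cat !big_map /=.
rewrite big_split /=; congr (_ + _).
  rewrite -sum1_size big_distrr /= big_seq [RHS]big_seq; apply: eq_bigr => P Pin.
  rewrite muln1 -(sum_eq_words (k == 1) Pin) big_seq [RHS]big_seq; apply: eq_bigr => Q Qin.
  rewrite lin_01_10_head0 ?nonadjF ?(words_nonadj Pin) ?(words_nonadj Qin) //=.
  by rewrite (words_size Pin) (words_size Qin).
rewrite wordsS big_cat !big_map /= [X in X + _]big_seq.
rewrite [X in X + _]big1 ?add0n => [|P Pin]; last first.
  rewrite big_seq big1 // => Q Qin; rewrite lin_0100_1010 //.
  - by rewrite (words_size Pin) (words_size Qin).
  - exact: words_nonadj Pin.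
  exact: words_nonadj Qin.
rewrite big_filter big_distrr /= big_seq_cond [RHS]big_seq_cond.
apply: eq_bigr => P /andP[Pin hP].
rewrite big_distrr /= big_seq [RHS]big_seq; apply: eq_bigr => Q Qin.
rewrite lin_0101_1010 ?mulnb // ?nonadjT ?hP ?(words_nonadj Pin) //.
by rewrite (words_size Pin) (words_size Qin).
Qed.

(** Each [P] is matched with [Q = zap P]; the last term is the pair of exceptional intervals
    [[001, 101]] and [[000, 101]]. The factor [1 < k] guards the truncated [k.-2]. *)
Lemma nlin00E N k :
  nlin00 N k = (1 < k) * nlead N k.-2 + (N == 1) * ((k == 3) + (k == 4)).
Proof.
have eqS : (1 < k) * nlead N k.-2 = \sum_(P <- words N) (k == (lead P).+2).
  case: k => [|[|k]]; rewrite ?mul0n ?mul1n; try by rewrite big1.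
  by apply: eq_bigr => P _; rewrite eq_sym.
rewrite {}eqS; have zap_in P : P \in words N -> zap P \in words N.
  by rewrite !mem_words size_zap => /andP[/nonadj_zap -> ->].
have eqin P : P \in words N ->
    \sum_(Q <- words N) lin k [:: false, false & P] [:: true, false & Q] =
    (k == (lead P).+2) + (N == 1) * (k == lead P + 3).
  move=> Pin; rewrite -(sum_eq_words (k == (lead P).+2) (zap_in _ Pin)).
  have <- : \sum_(Q <- words N) ((Q == [:: true]) && (k == lead P + 3)) =
            (N == 1) * (k == lead P + 3).
    have [eN|nN] := eqVneq N 1; first by rewrite mul1n eN sum_eq_words.
    rewrite big_seq big1 // => Q Qin; case: eqP => // eQ.
    by case/eqP: nN; rewrite -(words_size Qin) eQ.
  rewrite -big_split big_seq [RHS]big_seq; apply: eq_bigr => Q Qin.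
  rewrite lin_00_10 ?(words_size Pin) ?(words_size Qin) //=; last 2 first.
  - exact: words_nonadj Pin.
  - exact: words_nonadj Qin.
  case: (Q =P zap P) => [->|] //; case: (zap P =P _) => [eQ|]; last by rewrite addn0.
  by have := head_zap P; rewrite eQ.
rewrite /nlin00 big_seq (eq_bigr _ eqin) -big_seq big_split /=; congr (_ + _).
rewrite -big_distrr /=; case: eqP => // ->; rewrite !mul1n.
by rewrite /words !(big_cons, big_nil) /= addn0 addnC.
Qed.

Lemma nlead0 j : nlead 0 j = (j == 0).
Proof. by rewrite /nlead big_seq1 eq_sym. Qed.

Lemma nleadS N j : nlead N.+1 j =
  (0 < j) * nlead N j.-1 + (j == 0) * (if N is M.+1 then size (words M) else 1).
Proof.
rewrite /nlead wordsS big_cat !big_map /=; congr (_ + _).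
  case: j => [|j]; rewrite ?mul0n ?mul1n; first by rewrite big1.
  by apply: eq_bigr => P _; rewrite eqSS.
rewrite big_const_seq count_predT iter_addn_0 eq_sym.
by case: N => [//|N]; rewrite words_head0 size_map.
Qed.

Lemma size_wordsSS N : size (words N.+2) = size (words N.+1) + size (words N).
Proof. by rewrite wordsSS size_cat !size_map. Qed.

(** * Encoding of the paths by words *)

Fixpoint enc (w : seq bool) : seq bool :=
  match w with
  | true :: w' => false :: enc w'
  | false :: w' => [:: true, false & enc w']
  | [::] => [::]
  end.

(** The path read from right to left. The final run of up steps has the length that balances the
    [size w + 1] down steps. *)
Definition rpath (w : seq bool) : seq bool :=
  false :: enc w ++ nseq (count id w).+1 true.

Lemma count_enc_id w : count id (enc w) = count negb w.
Proof. by elim: w => [|[] w IHw] //=; rewrite IHw. Qed.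

Lemma count_enc_negb w : count negb (enc w) = size w.
Proof. by elim: w => [|[] w IHw] //=; rewrite IHw. Qed.

Lemma size_count (w : seq bool) : size w = count id w + count negb w.
Proof. by rewrite -(count_predC id). Qed.

Lemma count_rpath_id w : count id (rpath w) = (size w).+1.
Proof.
by rewrite /rpath -cat1s !count_cat count_enc_id count_nseq size_count /=; lia.
Qed.

Lemma count_rpath_negb w : count negb (rpath w) = (size w).+1.
Proof.
by rewrite /rpath -cat1s !count_cat count_enc_negb count_nseq /=; lia.
Qed.

Lemma size_rpath w : size (rpath w) = (size w).+1.*2.
Proof. by rewrite size_count count_rpath_id count_rpath_negb addnn. Qed.

(* Both sides say that the D of index j is among the first i steps, since its
   position is j + 1 plus the number of UD blocks up to it. *)
Lemma count_take_enc w m i j :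
  (j < count negb (take i (enc w ++ nseq m true))) =
  (j < size w) && (j.+1 + count negb (take j.+1 w) <= i).
Proof.
elim: w i j => [|[] w IHw] i j.
- rewrite /= (_ : count negb _ = 0) //.
  by elim: m i => [|m IHm] [|i] //=; rewrite IHm.
- case: i => [|i] /=; first by rewrite ?take0 andbF.
  case: j => [|j]; first by rewrite ?take0 /=; lia.
  by rewrite add1n ltnS IHw !ltnS add0n.
case: i => [|[|i]] /=; try by rewrite ?take0 ?andbF // ; lia.
case: j => [|j]; first by rewrite take0 /=; lia.
by rewrite add0n add1n ltnS IHw ltnS; lia.
Qed.

Lemma take_rpath i w : count negb (take i.+1 (rpath w)) =
  (count negb (take i (enc w ++ nseq (count id w).+1 true))).+1.
Proof. by []. Qed.

(** By [count_take_enc], the D of index j sits at 2(j + 1) minus the prefix sum of length j + 1, so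
    larger prefix sums mean earlier D steps. *)
Lemma dom_rpath P Q : size P = size Q ->
  dom 0 P Q <->
  forall i, count negb (take i (rpath P)) <= count negb (take i (rpath Q)).
Proof.
move=> ePQ; have cF (w : seq bool) i : i <= size w ->
    count id (take i w) + count negb (take i w) = i.
  by move=> lei; rewrite -size_count size_takel.
split=> [/domP-/(_ ePQ) le_i [|i]|le_i]; rewrite ?take0 //.
  rewrite !take_rpath ltnS leqNgt count_take_enc; apply/negP => /andP[].
  (* With [j] the number of D steps in this prefix for [Q], the D of index [j] would already be
     reached for [P], hence also for [Q], giving [j < j]. *)
  set j := count _ _ => ltj lei.
  have: j < j by rewrite {2}/j count_take_enc -ePQ ltj /=; have := le_i j.+1;
    have := cF _ _ ltj; have := cF Q j.+1; rewrite -ePQ => /(_ ltj); lia.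
  by rewrite ltnn.
apply/domP => // i; rewrite add0n.
wlog lei : i / i <= size P.
  move=> h; case: (leqP i (size P)) => [/h //|/ltnW ltPi].
  have := h _ (leqnn _); rewrite !take_oversize // ?ePQ // -ePQ //.
case: i lei => [|i] lei; first by rewrite !take0.
(* This prefix of [rpath P] ends at the D of index [i] of [enc P]; the outer successor accounts for
   the leading D. *)
have := le_i (i.+1 + count negb (take i.+1 P)).+1.
rewrite !take_rpath ltnS => h.
have: i < count negb (take (i.+1 + count negb (take i.+1 P))
      (enc P ++ nseq (count id P).+1 true)).
  by rewrite count_take_enc lei leqnn.
move/leq_trans/(_ h); rewrite count_take_enc -ePQ lei /=.
have := cF _ _ lei; have := cF Q i.+1; rewrite -ePQ => /(_ lei); lia.
Qed.

Lemma rpath_inj P Q : size P = size Q -> rpath P = rpath Q -> P = Q.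
Proof.
by move=> ePQ e; apply: dom_anti => //; apply/dom_rpath; rewrite ?e.
Qed.

(** Here [e] is the height already gained. A letter 1 raises it and pays for one final up step; a
    letter 0 dips by one and returns, which needs [0 < e]. *)
Lemma count_take_enc_le w e i m : 0 < e -> m <= e + count id w ->
  count id (take i (enc w ++ nseq m true)) <=
  e + count negb (take i (enc w ++ nseq m true)).
Proof.
elim: w e i => [|[] w IHw] e i e0 lem.
- rewrite [enc _ ++ _]/=; move: lem; rewrite [count _ _]/= addn0 => lem.
  apply: leq_trans (leq_addr _ _); apply: leq_trans (count_size _ _) _.
  by rewrite size_take size_nseq; case: ltnP; lia.
- case: i => [|i] //; rewrite [take _ _]/= [count id _]/= [count negb _]/=.
  by have := IHw e.+1 i; move: lem => /=; lia.
case: i => [|[|i]] //; rewrite [take _ _]/= ?take0 /=.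
  by move: lem => /=; lia.
by have := IHw e i; move: lem => /=; lia.
Qed.

Lemma take_rpath_le w i : count id (take i (rpath w)) <= count negb (take i (rpath w)).
Proof.
case: i => [|i] //; rewrite take_rpath [take _ _]/= [count id _]/= add0n.
by rewrite -add1n; apply: count_take_enc_le.
Qed.

Lemma count_mem_id (s : seq bool) : count_mem true s = count id s.
Proof. by apply: eq_count; case. Qed.

Lemma count_mem_negb (s : seq bool) : count_mem false s = count negb s.
Proof. by apply: eq_count; case. Qed.

Lemma ordinate_rev r i : count id r = count negb r ->
  ordinate (rev r) i = ((count negb (take (size r - i) r))%:Z
                        - (count id (take (size r - i) r))%:Z)%R.
Proof.
rewrite /ordinate count_mem_id count_mem_negb take_rev !count_rev.
set j := size r - i; rewrite -{1 2}(cat_take_drop j r) !count_cat; lia.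
Qed.

Lemma infix_UUD_nseq r : ~~ infix [:: true; true; false] [:: true, true & r] ->
  r = nseq (size r) true.
Proof.
elim: r => [|a r IHr] // inf; case: a inf => inf; last by move: inf; rewrite /= prefix0s.
by rewrite /= -IHr //; move: inf; rewrite [infix _ _]/= => /norP[].
Qed.

(** A leading D or UD is split off as a block; a leading UU can be followed by U only. *)
Lemma enc_decode r : ~~ infix [:: true; true; false] r ->
  exists w (m : nat), r = enc w ++ nseq m true.
Proof.
elim: {r}(size r) {-2}r (leqnn (size r)) => [|n IHn] [|[] r] //.
- by exists [::], 0.
- by exists [::], 0.
- case: r => [|[] r] ltrn inf; first by exists [::], 1.
    by exists [::], (size r).+2; rewrite /= -(infix_UUD_nseq inf).
  have [||w [m ->]] := IHn r; first by move: ltrn => /=; lia.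
    by apply: contra inf => /= ->; rewrite ?orbT.
  by exists (false :: w), m.
move=> ltrn inf; have [||w [m ->]] := IHn r; first by [].
  by apply: contra inf => /= ->; rewrite ?orbT.
by exists (true :: w), m.
Qed.

(** Every block ends in D, and so does what precedes the first one; two adjacent 1s would therefore
    complete a DDD. *)
Lemma nonadj_enc w s : ~~ infix [:: false; false; false] (false :: enc w ++ s) -> nonadj w.
Proof.
elim: w => [|a w IHw] // inf; have {IHw} naw : nonadj w.
  apply: IHw; apply: contra inf; case: a => /= infw; first by rewrite infw orbT.
  by rewrite infw ?orbT.
rewrite -[nonadj _]/(nonadj (a :: w)); case: a inf => // inf.
by case: w inf naw => [|[] w] //=; rewrite prefix0s.
Qed.

Lemma infix_nseq_true a m : false \in a -> infix a (nseq m true) = false.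
Proof.
by move=> ain; apply/negP => /mem_infix/(_ _ ain); rewrite mem_nseq andbF.
Qed.

Lemma infix_enc_UUD w m : ~~ infix [:: true; true; false] (enc w ++ nseq m true).
Proof.
elim: w => [|[] w IHw] //=; first by rewrite infix_nseq_true.
Qed.

Lemma infix_enc_DDD w m : nonadj w ->
  ~~ infix [:: false; false; false] (false :: enc w ++ nseq m true).
Proof.
elim: w => [|[] w IHw] naw.
- by rewrite /= infix_nseq_true // orbF; case: m.
- case: w naw IHw => [|[] w] // naw IHw; last by have := IHw naw; rewrite /= negb_or.
  by rewrite /= infix_nseq_true // orbF; case: m {IHw}.
by have := IHw naw.
Qed.

Lemma inF2_decode N r : inF2 (rev r) -> size r = N.+1.*2 ->
  exists2 w, w \in words N & rpath w = r.
Proof.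
case/and3P => /andP[/allP pos /eqP fin] avU avD sr.
have cr : count id r = count negb r.
  move: fin; rewrite /ordinate take_size count_mem_id count_mem_negb !count_rev; lia.
(* The height before the last step of the path is nonnegative, so that step, the first letter of
   [r], is D. *)
have : (0 <= ordinate (rev r) (size r).-1)%R.
  by apply: pos; rewrite mem_iota size_rev sr; lia.
rewrite ordinate_rev // (_ : size r - (size r).-1 = 1); last by rewrite sr; lia.
have {}avU : ~~ infix [:: true; true; false] r by rewrite -infix_rev.
have {}avD : ~~ infix [:: false; false; false] r by rewrite -infix_rev.
case: r cr sr avU avD {pos fin} => [|a r] // cr sr avU avD; rewrite [take _ _]/= take0 => a0.
case: a a0 cr sr avU avD => // _ cr sr avU avD.
have [w [m er]] : exists w (m : nat), r = enc w ++ nseq m true.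
  by apply: enc_decode; apply: contra avU => /= ->; rewrite ?orbT.
have naw : nonadj w by apply: (@nonadj_enc _ (nseq m true)); rewrite -er.
move: cr sr; rewrite er size_count /= !count_cat count_enc_id count_enc_negb !count_nseq /=.
move=> cr sr; have sw : size w = N by lia.
exists w; first by rewrite mem_words naw sw eqxx.
by rewrite /rpath; congr (_ :: _ ++ nseq _ _); move: (size_count w); lia.
Qed.

Lemma inF2_rpath w : nonadj w -> inF2 (rev (rpath w)).
Proof.
move=> naw; have cr : count id (rpath w) = count negb (rpath w).
  by rewrite count_rpath_id count_rpath_negb.
apply/and3P; split.
- apply/andP; split; last by rewrite ordinate_rev // size_rev subnn take0.
  by apply/allP => i _; rewrite ordinate_rev //; have := take_rpath_le w (size (rpath w) - i); lia.
- rewrite /avoids (infix_rev [:: true; true; false]).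
  exact: (infix_enc_UUD w (count id w).+1).
rewrite /avoids (infix_rev [:: false; false; false]).
exact: infix_enc_DDD.
Qed.

(** An isomorphism of posets, given as a permutation of lists so that sums over paths become sums
    over [words N]. *)
Lemma F2_words N : exists psi : F2 N.+1 -> seq bool,
  [/\ injective psi, perm_eq (map psi (enum {: F2 N.+1})) (words N) &
      forall p q, (p <= q)%O = dom 0 (psi p) (psi q)].
Proof.
(* Both conditions are boolean, as [sig2W] requires to choose a word. *)
have dec (p : F2 N.+1) : exists2 w, w \in words N & rpath w == rev p.
  have [w win ew] : exists2 w, w \in words N & rpath w = rev p.
    by apply: inF2_decode; rewrite ?revK ?size_rev ?size_tuple //; case: p.
  by exists w => //; apply/eqP.
have [psi psi_in rpsi] : exists2 psi : F2 N.+1 -> seq bool,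
    (forall p, psi p \in words N) & (forall p, rpath (psi p) = rev p).
  exists (fun p => s2val (sig2W (dec p))) => p; first exact: (s2valP (sig2W (dec p))).
  exact: eqP (s2valP' (sig2W (dec p))).
have psi_size p : size (psi p) = N := words_size (psi_in p).
have psi_inj : injective psi.
  move=> p q /(congr1 rpath); rewrite !rpsi => /(congr1 rev); rewrite !revK => epq.
  exact/val_inj/val_inj.
exists psi; split=> // [|p q].
  apply: uniq_perm => [||w]; [|exact: words_uniq|].
    by rewrite map_inj_uniq // enum_uniq.
  apply/mapP/idP => [[p _ ->] //|win].
  have sw : size (rev (rpath w)) == N.+1.*2.
    by rewrite size_rev size_rpath (words_size win).
  exists (MkF2 (f2word := Tuple sw) (inF2_rpath (words_nonadj win))).
    by rewrite mem_enum.
  apply: rpath_inj; first by rewrite psi_size (words_size win).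
  by rewrite rpsi /= revK.
(* The height is the number of D minus the number of U among the steps to the right, so comparing
   heights amounts to comparing numbers of D. *)
have ordE (s : F2 N.+1) i : i <= N.+1.*2 -> ordinate s i =
    ((count negb (take (N.+1.*2 - i) (rpath (psi s)))).*2%:Z - (N.+1.*2 - i)%:Z)%R.
  move=> lei; rewrite -{1}(revK s) -rpsi ordinate_rev; last first.
    by rewrite count_rpath_id count_rpath_negb.
  rewrite size_rpath psi_size; set j := _ - i.
  have := size_count (take j (rpath (psi s))).
  rewrite size_takel ?size_rpath ?psi_size ?leq_subr //; lia.
have eqS : size (psi p) = size (psi q) by rewrite !psi_size.
apply/forallP/idP => [le_i|/(dom_rpath eqS) le_i i]; last first.
  have lei : i <= N.+1.*2 by rewrite -ltnS.
  have := le_i (N.+1.*2 - i); rewrite !ordE //; clear -lei; lia.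
apply/(dom_rpath eqS) => i.
wlog lei : i / i <= N.+1.*2.
  move=> h; case: (leqP i (N.+1.*2)) => [/h //|/ltnW lti].
  by have := h _ (leqnn _); rewrite !take_oversize // size_rpath psi_size.
have lt' : N.+1.*2 - i < N.+1.*2.+1 by rewrite ltnS leq_subr.
by have := le_i (Ordinal lt'); rewrite !ordE ?leq_subr //= subKn //; lia.
Qed.

(** * From intervals in a finite poset to pairs of endpoints *)

(** A chain is its own unique maximal chain. *)
Lemma height_chain d (T : finPOrderType d) (I : {set T}) : is_chain I -> height I = #|I|.-1.
Proof.
move=> chI; rewrite /height (big_pred1 I) // => C /=.
apply/maxsetP/eqP => [[/andP[sCI _] /(_ I)->] //|->]; first by rewrite subxx.
rewrite subxx chI; split=> // B /andP[sBI _] sIB.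
by apply/eqP; rewrite eqEsubset sBI.
Qed.

(** A nonempty interval determines its endpoints, and pairs not in order are discarded because their
    interval is empty. *)
Lemma card_linear_intervals d (T : finPOrderType d) k :
  #|linear_intervals T k| =
  \sum_(p : T) \sum_(q : T) (is_chain (poset_itv p q) && (#|poset_itv p q| == k.+1)).
Proof.
pose A := [set pq : T * T | is_chain (poset_itv pq.1 pq.2) &
                            #|poset_itv pq.1 pq.2| == k.+1].
have leA pq : pq \in A -> (pq.1 <= pq.2)%O.
  rewrite inE => /andP[_ /eqP card_pq].
  have /card_gt0P[s] : 0 < #|poset_itv pq.1 pq.2| by rewrite card_pq.
  by rewrite inE => /andP[]; apply: le_trans.
have -> : linear_intervals T k = [set poset_itv pq.1 pq.2 | pq in A].
  apply/setP => I; rewrite inE; apply/andP/imsetP.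
    case; rewrite inE => /existsP[p /existsP[q /andP[lepq /eqP ->]]] /andP[ch].
    rewrite height_chain // => /eqP eqk; exists (p, q) => //; rewrite inE /= ch -eqk.
    by rewrite prednK ?eqxx //; apply/card_gt0P; exists p; rewrite inE lexx.
  case=> pq pqA ->; have lepq := leA _ pqA; move: pqA; rewrite inE => /andP[ch /eqP card_pq].
  split; last by rewrite ch height_chain // card_pq eqxx.
  by rewrite inE; apply/existsP; exists pq.1; apply/existsP; exists pq.2; rewrite lepq eqxx.
rewrite card_in_imset => [|[p q] [p' q'] pqA pqA' /= /setP eqI].
  by rewrite -sum1_card big_mkcond pair_big /=; apply: eq_bigr => -[p q] _; rewrite inE.
have := eqI p; have := eqI q; have := eqI p'; have := eqI q'; rewrite !inE.
have := leA _ pqA; have := leA _ pqA' => /= le' le; rewrite !lexx le le' /=.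
move=> /andP[_ ?] /andP[? _] /esym/andP[_ ?] /esym/andP[? _].
by congr pair; apply: le_anti; apply/andP.
Qed.

Lemma ellS N k : ell N.+1 k = nlin N k.
Proof.
have [psi [psi_inj psi_words le_psi]] := F2_words N.
rewrite /ell card_linear_intervals /nlin -(perm_big _ psi_words) big_map big_enum.
apply: eq_bigr => p _; rewrite -(perm_big _ psi_words) big_map big_enum.
apply: eq_bigr => q _; congr nat_of_bool.
have psi_in s : psi s \in words N.
  by rewrite -(perm_mem psi_words); apply: map_f; rewrite mem_enum.
have eqp : perm_eq (map psi (enum (poset_itv p q))) (itv (psi p) (psi q)).
  apply: uniq_perm; rewrite ?filter_uniq ?words_uniq ?map_inj_uniq ?enum_uniq // => w.
  rewrite mem_filter (words_size (psi_in p)); apply/mapP/andP => [[s]|[lew]].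
    by rewrite mem_enum inE !le_psi => ? ->.
  rewrite -(perm_mem psi_words) => /mapP[s _ ew]; exists s => //.
  by rewrite mem_enum inE !le_psi -ew.
rewrite /lin -(perm_size eqp) size_map -cardE andbC; congr (_ && _).
rewrite -(eq_allrel_meml _ _ (perm_mem eqp)) -(eq_allrel_memr _ _ (perm_mem eqp)).
rewrite allrel_mapl allrel_mapr; apply/idP/allrelP => [ch s t|ch].
  rewrite !mem_enum => sI tI; move/forall_inP/(_ s sI)/forall_inP/(_ t tI): ch.
  by rewrite /= /wcomparable -!le_psi.
apply/forall_inP => s sI; apply/forall_inP => t tI.
by have := ch s t; rewrite !mem_enum /= /wcomparable -!le_psi; apply.
Qed.

(** The encoding starts from a last step D, so the empty path is treated apart. *)
Lemma ell0 k : ell 0 k = (k == 0).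
Proof.
have in0 : inF2 ([tuple] : (0.*2).-tuple bool) by [].
have eq0 (p : F2 0) : p = MkF2 in0.
  by apply/val_inj/val_inj => /=; have := size_tuple (f2word p); case: (tval _).
have all0 (f : F2 0 -> nat) : \sum_p f p = f (MkF2 in0).
  by rewrite (big_pred1 (MkF2 in0)) // => p; apply/esym/eqP.
rewrite /ell card_linear_intervals !all0.
have -> : poset_itv (MkF2 in0) (MkF2 in0) = [set MkF2 in0].
  by apply/setP => p; rewrite [p]eq0 !inE lexx; apply/esym/eqP.
rewrite cards1 eqSS [0 == k]eq_sym (_ : is_chain _ = true) //.
apply/forall_inP => p _; apply/forall_inP => q _.
by rewrite [p]eq0 [q]eq0 comparablexx.
Qed.

(** * Generating functions *)

Local Open Scope ring_scope.

Definition coef2 (f : fps2 int) n k : int := fcoef (fcoef f n) k.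

Lemma fps2P (f g : fps2 int) : (forall n k, coef2 f n k = coef2 g n k) -> f = g.
Proof. by move=> e; apply: fpsP => n; apply: fpsP => k; apply: e. Qed.

Lemma coef_var (R : comNzRingType) (f : fps R) n :
  fcoef (fps_var R * f) n = if n is m.+1 then fcoef f m else 0.
Proof.
case: n => [|n]; first by rewrite /= big_ord1 mul0r.
rewrite /= big_ord_recl mul0r add0r big_ord_recl mul1r subn1 /= big1 ?addr0 //.
by move=> i _; rewrite mul0r.
Qed.

Lemma coef_const (R : comNzRingType) (c : R) (f : fps R) n :
  fcoef (fps_const c * f) n = c * fcoef f n.
Proof.
rewrite /= big_ord_recl subn0 /= big1 ?addr0 //.
by move=> i _; rewrite mul0r.
Qed.

Lemma coef2_x f n k :
  coef2 (varx int * f) n k = if n is m.+1 then coef2 f m k else 0.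
Proof. by rewrite /coef2 coef_var; case: n. Qed.

Lemma coef2_y f n k :
  coef2 (vary int * f) n k = if k is j.+1 then coef2 f n j else 0.
Proof. by rewrite /coef2 coef_const coef_var; case: k. Qed.

Lemma coef2D f g n k : coef2 (f + g) n k = coef2 f n k + coef2 g n k.
Proof. by []. Qed.

Lemma coef2_1 n k : coef2 1 n k = ((n == 0%N) && (k == 0%N))%:Z.
Proof. by case: n k => [|n] [|k]. Qed.

Lemma coef2_gf a n k : coef2 (gf2 a) n k = a n k.
Proof. by []. Qed.

Definition coef2E := (coef2D, coef2_x, coef2_y, coef2_1, coef2_gf).

Local Notation gfn a := (gf2 (fun n k : nat => (a n k)%:Z)).
Local Notation X := (varx int).
Local Notation Y := (vary int).

(** Here and in the next equations, products by [X] and [Y] are nested and end in a series or in 1,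
    so that [coef2E] computes every coefficient. The terms outside the recursion supply the initial
    values. *)
Lemma gf_words (W := gfn (fun n k => (size (words n) * (k == 0))%N)) :
  W = X * W + X * (X * W) + 1 + X * 1.
Proof.
rewrite {}/W; apply: fps2P => -[|[|n]] [|k]; do 3?rewrite !coef2E /=; rewrite ?size_wordsSS; lia.
Qed.

Lemma gf_nlead (W := gfn (fun n k => (size (words n) * (k == 0))%N)) (S := gfn nlead) :
  S = Y * (X * S) + 1 + X * 1 + X * (X * W).
Proof.
rewrite {}/S {}/W; apply: fps2P => -[|[|n]] [|k]; do 3?rewrite !coef2E /=;
  rewrite ?nleadS ?nlead0 /=; lia.
Qed.

Lemma gf_nlin01 (W := gfn (fun n k => (size (words n) * (k == 0))%N)) (V := gfn nlin01) :
  V = Y * (X * W) + Y * 1 + X * (Y * (Y * 1)) + X * (X * (Y * V)).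
Proof.
rewrite {}/V {}/W; apply: fps2P => -[|[|n]] [|[|[|k]]]; do 4?rewrite !coef2E /=;
  rewrite ?nlin01SS ?nlin01_0 ?nlin01_1 /=; lia.
Qed.

Lemma gf_nlin00 (S := gfn nlead) :
  gfn nlin00 = Y * (Y * S) + X * (Y * (Y * (Y * 1))) + X * (Y * (Y * (Y * (Y * 1)))).
Proof.
rewrite {}/S; apply: fps2P => -[|[|n]] [|[|[|[|[|k]]]]]; do 6?rewrite !coef2E /=;
  rewrite nlin00E /=; lia.
Qed.

Lemma gf_nlin (L := gfn nlin) :
  L = X * L + X * (X * L) + X * (X * (gfn nlin01 + gfn nlin00)) + 1 + X * (1 + Y * 1).
Proof.
rewrite {}/L; apply: fps2P => -[|[|n]] [|[|k]]; do 4?rewrite !coef2E /=;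
  rewrite ?nlinSS ?nlin0 ?nlin1 /=; lia.
Qed.

Lemma gf_ell : gfn ell = 1 + X * gfn nlin.
Proof.
apply: fps2P => -[|n] [|k]; do 2?rewrite !coef2E /=; rewrite ?ell0 ?ellS /=; lia.
Qed.

Lemma fps_unitE (R : comUnitRingType) (f : fps R) :
  (f \is a GRing.unit) = (fcoef f 0%N \is a GRing.unit).
Proof. by []. Qed.

Lemma solve_gf (R : comUnitRingType) (x y W S V H L : R) :
    W = x * W + x * (x * W) + 1 + x * 1 ->
    S = y * (x * S) + 1 + x * 1 + x * (x * W) ->
    V = y * (x * W) + y * 1 + x * (y * (y * 1)) + x * (x * (y * V)) ->
    H = y * (y * S) + x * (y * (y * (y * 1))) + x * (y * (y * (y * (y * 1)))) ->
    L = x * L + x * (x * L) + x * (x * (V + H)) + 1 + x * (1 + y * 1) ->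
    1 - x - x ^+ 2 \is a GRing.unit ->
    x * y - 1 \is a GRing.unit -> x ^+ 2 * y - 1 \is a GRing.unit ->
  1 + x * L =
    (x ^+ 4 * y ^+ 4 + x ^+ 4 * y ^+ 3 + 1) / (1 - x - x ^+ 2)
    + (x ^+ 2 * y * (x ^+ 2 - 1) * (x ^+ 3 * y ^+ 2 - 1))
      / ((x * y - 1) * (x ^+ 2 + x - 1) ^+ 2 * (x ^+ 2 * y - 1)).
Proof.
move=> eW eS eV -> eL uu ua ub; pose u := 1 - x - x ^+ 2.
(* The base of the square is [- u]. *)
have -> : (x ^+ 2 + x - 1) ^+ 2 = u ^+ 2 by rewrite /u; ring.
rewrite -/u in uu *; set a := x * y - 1 in ua *; set b := x ^+ 2 * y - 1 in ub *.
have ud : a * u ^+ 2 * b \is a GRing.unit by rewrite !unitrM ua ub uu.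
apply: (mulIr ud); rewrite [RHS]mulrDl divrK //.
rewrite (_ : a * u ^+ 2 * b = u * (a * u * b)) ?[_ / u * _]mulrA ?divrK //; last by ring.
apply/eqP; rewrite -subr_eq0.
set lhs := (X in X == 0).
(* The multipliers come from back substitution: in the equations for [L], [V], [S] and [W] the
   unknown has total coefficient [u], [- b], [- a] and [u]. *)
have -> : lhs =
    x * u * a * b * (L - (x * L + x * (x * L) + x * (x * (V +
      (y * (y * S) + x * (y * (y * (y * 1))) + x * (y * (y * (y * (y * 1)))))))
      + 1 + x * (1 + y * 1)))
  - x ^+ 3 * u * a *
      (V - (y * (x * W) + y * 1 + x * (y * (y * 1)) + x * (x * (y * V))))
  - x ^+ 3 * y ^+ 2 * u * b * (S - (y * (x * S) + 1 + x * 1 + x * (x * W)))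
  - (x ^+ 4 * y * a + x ^+ 5 * y ^+ 2 * b) *
      (W - (x * W + x * (x * W) + 1 + x * 1)).
  by rewrite /lhs /u /a /b; ring.
by rewrite -eL -eV -eS -eW !subrr !mulr0 !subr0.
Qed.

Theorem theorem3p4 :
  let x := varx int in
  let y := vary int in
  gf2 (fun n k : nat => (ell n k)%:Z) =
    (x ^+ 4 * y ^+ 4 + x ^+ 4 * y ^+ 3 + 1) / (1 - x - x ^+ 2)
    + (x ^+ 2 * y * (x ^+ 2 - 1) * (x ^+ 3 * y ^+ 2 - 1))
      / ((x * y - 1) * (x ^+ 2 + x - 1) ^+ 2 * (x ^+ 2 * y - 1)).
Proof.
have unit1 f : coef2 f 0 0 = 1 \/ coef2 f 0 0 = -1 -> f \is a GRing.unit.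
  by rewrite 2!fps_unitE -/(coef2 f 0 0) => -[] ->.
have unitN f : coef2 f 0 0 = 0 -> f - 1 \is a GRing.unit.
  by move=> f0; apply: unit1; right; rewrite coef2D f0.
move=> x y; rewrite gf_ell.
apply: solve_gf gf_words gf_nlead gf_nlin01 gf_nlin00 gf_nlin _ _ _.
(* Written as a multiple of [x] minus 1, up to sign, to expose the constant coefficient. *)
- rewrite (_ : 1 - x - x ^+ 2 = - (x * (1 + x) - 1)); last by ring.
  by rewrite unitrN unitN // coef2_x.
- by rewrite unitN // coef2_x.
by rewrite unitN // expr2 -mulrA coef2_x.
Qed.
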